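(* Let $\theta$ be a $B$-action and let $(X,d_\theta)$ be a $\theta$-metric space. Then $(X,\tau_{d_\theta})$ is a Hausdorff topological space.
   Context: A $B$-action is a map $\theta:[0,+\infty)\times[0,+\infty)\to[0,+\infty)$, continuous with respect to each variable, such that, with $\mathrm{Im}(\theta)=\{\theta(s,t):s,t\ge 0\}$: (I) $\theta(0,0)=0$ and $\theta(t,s)=\theta(s,t)$ for all $t,s\ge 0$; (II) $\theta(s,t)<\theta(u,v)$ whenever either $s<u$ and $t\le v$, or $s\le u$ and $t<v$; (III) for each $r\in \mathrm{Im}(\theta)\setminus\{0\}$ and each $s\in(0,r]$ there exists $t\in[0,r]$ with $\theta(t,s)=r$; (IV) $\theta(s,0)\le s$ for all $s>0$. A $\theta$-metric on a nonempty set $X$ is a map $d_\theta:X\times X\to[0,+\infty)$ such that for all $x,y,z\in X$: $d_\theta(x,y)=0$ iff $x=y$; $d_\theta(x,y)=d_\theta(y,x)$; $d_\theta(x,y)\le\theta(d_\theta(x,z),d_\theta(z,y))$. Then $(X,d_\theta)$ is called a $\theta$-metric space. For $x\in X$ and $r\in \mathrm{Im}(\theta)$ put $B_{d_\theta}(x,r)=\{y\in X: d_\theta(x,y)<r\}$. The induced topology $\tau_{d_\theta}$ on $X$ consists of all $A\subset X$ such that for every $x\in A$ there is $r\in \mathrm{Im}(\theta)\setminus\{0\}$ with $B_{d_\theta}(x,r)\subset A$. *)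

(* Defs.v *)
From HB Require Import structures.
From mathcomp Require Import all_boot all_order all_algebra.
From mathcomp Require Import all_classical all_reals all_analysis.
Set Implicit Arguments.
Unset Strict Implicit.
Unset Printing Implicit Defensive.
Import Order.TTheory GRing.Theory Num.Theory.
Import numFieldNormedType.Exports.
Local Open Scope classical_set_scope.
Local Open Scope ring_scope.

(* A map [0,+oo[ x [0,+oo[ -> [0,+oo[ is encoded as a total function
   R -> R -> R whose values outside the nonnegative quadrant are irrelevant. *)
Definition theta_image (R : realType) (theta : R -> R -> R) : set R :=
  [set r | exists s t : R, [/\ 0 <= s, 0 <= t & r = theta s t]].

Record B_action (R : realType) (theta : R -> R -> R) : Prop := BAction {
  B_action_ge0 : forall s t : R, 0 <= s -> 0 <= t -> 0 <= theta s t;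
  B_action_continuousl : forall t : R, 0 <= t ->
    {within `[0, +oo[, continuous (fun s => theta s t)};
  B_action_continuousr : forall s : R, 0 <= s ->
    {within `[0, +oo[, continuous (fun t => theta s t)};
  B_action00 : theta 0 0 = 0;
  B_actionC : forall t s : R, 0 <= t -> 0 <= s -> theta t s = theta s t;
  B_action_lt : forall s t u v : R, 0 <= s -> 0 <= t -> 0 <= u -> 0 <= v ->
    (s < u /\ t <= v) \/ (s <= u /\ t < v) -> theta s t < theta u v;
  B_action_solve : forall r s : R, (theta_image theta `\ 0) r -> 0 < s <= r ->
    exists2 t : R, 0 <= t <= r & theta t s = r;
  B_action_le : forall s : R, 0 < s -> theta s 0 <= s
}.

Record theta_metric (R : realType) (theta : R -> R -> R) (X : Type)
    (d : X -> X -> R) : Prop := ThetaMetric {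
  theta_metric_ge0 : forall x y, 0 <= d x y;
  theta_metric_eq0 : forall x y, d x y = 0 <-> x = y;
  theta_metricC : forall x y, d x y = d y x;
  theta_metric_triangle : forall x y z, d x y <= theta (d x z) (d z y)
}.

Definition theta_ball (R : realType) (X : Type) (d : X -> X -> R)
    (x : X) (r : R) : set X := [set y | d x y < r].

Definition theta_topology (R : realType) (theta : R -> R -> R) (X : Type)
    (d : X -> X -> R) : set (set X) :=
  [set A | forall x, A x ->
    exists2 r, (theta_image theta `\ 0) r & theta_ball d x r `<=` A].

(* tau is the family of open sets of a topologicalType structure on the
   carrier X, and this topological space is Hausdorff.  The structure is
   determined by tau, up to the irrelevant choice operator on X. *)
Definition hausdorff_topology (X : Type) (tau : set (set X)) : Prop :=
  exists c : Topological.axioms_ X,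
    let T : topologicalType := Topological.Pack c in
    (@open T = tau :> set (set X)) /\ hausdorff_space T.

(* Main.v *)
(* Balls whose radii lie in the image of theta are open: if d x y = s < r and
   theta t s = r, then t > 0 by (IV), and the ball around y of radius
   theta t 0 <= t is contained in the ball around x of radius r, by strict
   monotonicity.  To separate x <> y at distance D, (IV) gives
   theta (D/2) 0 <= D/2 < D, so continuity gives v > 0 with theta (D/2) v < D;
   radii at most D/2 around x and at most v around y yield disjoint balls. *)
Require Import Defs.
From HB Require Import structures.
From mathcomp Require Import all_boot all_order all_algebra.
From mathcomp Require Import all_classical all_reals all_analysis.
From mathcomp Require Import lra.
Set Implicit Arguments.
Unset Strict Implicit.
Unset Printing Implicit Defensive.
Import Order.TTheory GRing.Theory Num.Theory.
Local Open Scope classical_set_scope.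
Local Open Scope ring_scope.

Lemma hausdorff_topologyI (X : Type) (tau : set (set X)) :
  tau setT -> setI_closed tau ->
  (forall (I : Type) (f : I -> set X),
    (forall i, tau (f i)) -> tau (\bigcup_i f i)) ->
  (forall x y, x <> y ->
    exists A B, [/\ tau A, tau B, A x, B y & A `&` B = set0]) ->
  hausdorff_topology tau.
Proof.
move=> tauT tauI tauU sep.
(* [X] is a bare type; [{classic X}] supplies classically the choice structure that a
   [topologicalType] requires. *)
pose t := @isOpenTopological.Build {classic X} tau tauT tauI tauU.
pose T : topologicalType := HB.pack {classic X} t.
exists (Topological.class T); split => //.
change (hausdorff_space T); rewrite open_hausdorff => x y /eqP xy.
have [A [B [tA tB Ax By AB0]]] := sep x y xy.
by exists (A, B); split; rewrite ?inE//; apply/eqP.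
Qed.

Lemma B_action_image_pos (R : realType) (theta : R -> R -> R) (r : R) :
  B_action theta -> (theta_image theta `\ 0) r -> 0 < r.
Proof.
move=> h [[s [t [s0 t0 ->]]] /eqP ne0].
by rewrite lt_neqAle eq_sym ne0 (B_action_ge0 h).
Qed.

(** Produces admissible radii: [theta t 0] exceeds [theta 0 0 = 0] by (II) and is at most [t] by
    (IV). *)
Lemma B_action_image_small (R : realType) (theta : R -> R -> R) (t : R) :
  B_action theta -> 0 < t -> exists2 r, (theta_image theta `\ 0) r & r <= t.
Proof.
move=> h t0; exists (theta t 0); last exact: B_action_le.
split; first by exists t, 0; split => //; exact: ltW.
apply/eqP; rewrite gt_eqF// -[ltLHS](B_action00 h).
by apply: (B_action_lt h); rewrite ?lexx ?(ltW t0)//; left.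
Qed.

Lemma theta_topology_ball (R : realType) (theta : R -> R -> R) (X : Type)
    (d : X -> X -> R) (x : X) (r : R) :
  B_action theta -> theta_metric theta d -> (theta_image theta `\ 0) r ->
  theta_topology theta d (theta_ball d x r).
Proof.
move=> h hd rI y; rewrite /theta_ball /= => xyr.
(* The centre is treated apart, since (III) needs [0 < d x y]. *)
have [/(theta_metric_eq0 hd) <-|xy0] := eqVneq (d x y) 0; first by exists r.
have s0 : 0 < d x y by rewrite lt_neqAle eq_sym xy0 (theta_metric_ge0 hd).
have [|t /andP[t0 _] tE] := B_action_solve h rI (s := d x y).
  by rewrite s0 ltW.
have {}t0 : 0 < t.
  (* If [t = 0], then [r = theta 0 (d x y) = theta (d x y) 0 <= d x y < r]. *)
  rewrite lt_neqAle t0 andbT; apply/eqP => t0E; move: xyr.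
  by rewrite -tE -t0E (B_actionC h) ?(ltW s0)// ltNge (B_action_le h).
have [u uI ut] := B_action_image_small h t0.
exists u => // z /= yz.
apply: le_lt_trans (theta_metric_triangle hd x z y) _.
rewrite -tE (B_actionC h (t := t)) ?ltW//.
apply: (B_action_lt h); rewrite ?(theta_metric_ge0 hd)//; first exact: ltW.
by right; split => //; exact: lt_le_trans ut.
Qed.

Lemma B_action_lt_small (R : realType) (theta : R -> R -> R) (s D : R) :
  B_action theta -> 0 < s -> s < D -> exists2 v, 0 < v & theta s v < D.
Proof.
move=> h s0 sD.
(* At the endpoint 0, continuity on the half-line is a right limit, so the witness [v] is sought
   along [0^'+]. *)
have /continuous_within_itvcyP[_ cv] := B_action_continuousr h (ltW s0).
have ltD : theta s 0 < D by exact: le_lt_trans (B_action_le h s0) sD.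
have : \forall v \near 0^'+, theta s v < D by exact: cvgr_lt cv _ ltD.
by move=> /(filterI (nbhs_right_gt 0))/filter_ex[v [/= v0 vD]]; exists v.
Qed.

Lemma theta_ball_separation (R : realType) (theta : R -> R -> R) (X : Type)
    (d : X -> X -> R) (x y : X) :
  B_action theta -> theta_metric theta d -> x <> y ->
  exists r1 r2, [/\ (theta_image theta `\ 0) r1, (theta_image theta `\ 0) r2 &
    theta_ball d x r1 `&` theta_ball d y r2 = set0].
Proof.
move=> h hd xy.
have D0 : 0 < d x y.
  rewrite lt_neqAle (theta_metric_ge0 hd) andbT eq_sym.
  by apply/eqP => /(theta_metric_eq0 hd).
have s0 : 0 < d x y / 2 by lra.
have [|v v0 vD] := B_action_lt_small h s0 (D := d x y); first by lra.
have [r1 r1I r1s] := B_action_image_small h s0.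
have [r2 r2I r2v] := B_action_image_small h v0.
exists r1, r2; split => //; apply/seteqP; split => // z [/= xz yz].
(* A common point [z] would give [d x y <= theta (d x z) (d z y) < theta (d x y / 2) v < d x y]. *)
suff : d x y < d x y by rewrite ltxx.
apply: le_lt_trans (theta_metric_triangle hd x y z) _.
apply: lt_trans vD; rewrite (theta_metricC hd z).
apply: (B_action_lt h); rewrite ?(theta_metric_ge0 hd) ?(ltW s0) ?(ltW v0)//.
by left; split; [exact: lt_le_trans r1s|exact/ltW/(lt_le_trans yz)].
Qed.

Theorem theorem2p1 (R : realType) (theta : R -> R -> R) (X : Type)
    (d : X -> X -> R) (hX : [set: X] !=set0)
    (htheta : B_action theta) (hd : theta_metric theta d) :
  hausdorff_topology (theta_topology theta d).
Proof.
apply: hausdorff_topologyI.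
- by move=> x _; have [r rI _] := B_action_image_small htheta ltr01; exists r.
- move=> A B tA tB x [/tA[r rI rA] /tB[s sI sB]].
  (* The minimum is one of the two radii, hence still a nonzero value of [theta]. *)
  exists (Num.min r s); first by rewrite minEle; case: ifP.
  by move=> z; rewrite /theta_ball /= lt_min => /andP[/rA ? /sB].
- move=> I f tf x [i _ /(tf i)[r rI rf]].
  by exists r => // z /rf ?; exists i.
- move=> x y xy.
  have [r [s [rI sI rs0]]] := theta_ball_separation htheta hd xy.
  have dxx z : d z z = 0 by exact/(theta_metric_eq0 hd).
  exists (theta_ball d x r), (theta_ball d y s); split => //.
  + exact: theta_topology_ball.
  + exact: theta_topology_ball.
  + by rewrite /theta_ball /= dxx (B_action_image_pos htheta).
  + by rewrite /theta_ball /= dxx (B_action_image_pos htheta).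
Qed.
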